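(* Let $X$ be a metric space, let $B_s\subseteq B_w\subseteq SM(X)$ be normed vector spaces of signed Borel measures with norms satisfying $\|\cdot\|_w\le\|\cdot\|_s$, and let $L_0,L_1$ be the transfer operators of two dynamical systems on $X$, with $L_i(B_s)\subseteq B_s$ and $L_i(B_w)\subseteq B_w$ for $i\in\{0,1\}$. Let $f_0,f_1\in B_s$ be probability measures with $L_0f_0=f_0$ and $L_1f_1=f_1$. Suppose: 1. there is $\phi\in C^0(\mathbb R)$, $\phi(t)$ decreasing to $0$ as $t\to\infty$, such that $L_0$ has convergence to equilibrium with respect to the norms $\|\cdot\|_w,\|\cdot\|_s$ with speed $\phi$; 2. there is $\tilde M\ge0$ such that $\max(\|f_1\|_s,\|f_0\|_s)\le\tilde M$; 3. there is $\tilde C\ge0$ such that $\|L_0^n\|_{B_w\to B_w}\le\tilde C$ for each $n$. Denote $$\epsilon:=\sup_{\|f\|_s\le1}\|(L_1-L_0)f\|_w$$ and consider the decreasing function $\psi(x)=\frac{\phi(x)}{x}$. Then $$\|f_1-f_0\|_w\le2\tilde M\tilde C\,\epsilon\left(\psi^{-1}\!\left(\frac{\epsilon\tilde C}{2}\right)+1\right).$$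
   Context: $SM(X)$ is the space of (finite) signed Borel measures on $X$. The transfer operator of a map $T:X\to X$ is the linear push-forward operator $L[\nu](B)=\nu(T^{-1}(B))$ for measurable $B$. Let $V_s=\{f\in B_s: f(X)=0\}$. $L_0$ has convergence to equilibrium with respect to $\|\cdot\|_w,\|\cdot\|_s$ with speed $\phi$ if $\|L_0^n(g)\|_w\le\phi(n)\|g\|_s$ for all $n$ and all $g\in V_s$. The function $\psi$ is considered on $(0,\infty)$, $\psi^{-1}$ is its inverse function, and the estimate is understood when $\epsilon\tilde C/2$ is in the range of $\psi$. *)

(* Defs.v *)
From HB Require Import structures.
From mathcomp Require Import all_boot all_order all_algebra.
From mathcomp Require Import all_classical all_reals all_analysis.

Set Implicit Arguments.
Unset Strict Implicit.
Unset Printing Implicit Defensive.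

Import Order.TTheory GRing.Theory Num.Theory.
Import numFieldNormedType.Exports.

Local Open Scope classical_set_scope.
Local Open Scope ring_scope.

(* In the library every measurable space is pointed. This costs no generality
   here: a metric space carrying a probability measure is nonempty. *)
#[short(type="pmetricType")]
HB.structure Definition PointedMetric (K : numDomainType) :=
  {M of Metric K M & isPointed M}.

Definition borel (R : realType) (X : pmetricType R) :=
  g_sigma_algebraType (@open X).

HB.instance Definition _ (R : realType) (X : pmetricType R) :=
  Measurable.on (borel X).

(* A library charge is finite and sigma-additive on measurable sets but takes
   arbitrary values on the other sets. Setting those values to 0 makes two
   signed measures equal exactly when they agree on every measurable set, and
   makes them a vector space. *)
Record signed_measure d (T : measurableType d) (R : realType) := SignedMeasure {
  charge_of :> {charge set T -> \bar R};
  charge_of_out : forall A, ~ measurable A -> charge_of A = 0%E }.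

Section signed_measure_theory.
Context d (T : measurableType d) (R : realType).
Local Notation SM := (signed_measure T R).

Lemma eq_charge (m1 m2 : {charge set T -> \bar R}) :
  (m1 = m2 :> (set T -> \bar R)) -> m1 = m2.
Proof.
move: m1 m2 => [m1 [[a1] [b1] [c1]]] [m2 [[a2] [b2] [c2]]] /= m1m2.
rewrite -{}m1m2 in a2 b2 c2 *.
by rewrite (Prop_irrelevance a1 a2) (Prop_irrelevance b1 b2)
           (Prop_irrelevance c1 c2).
Qed.

Lemma signed_measureP (m1 m2 : SM) :
  (forall A, measurable A -> m1 A = m2 A) <-> m1 = m2.
Proof.
split=> [m12|->//].
have /eq_charge : charge_of m1 = charge_of m2 :> (set T -> \bar R).
  apply/funext => A; have [/m12//|nA] := pselect (measurable A).
  by rewrite !charge_of_out.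
case: m1 m2 {m12} => [m1 o1] [m2 o2] /= m12; rewrite -{}m12 in o2 *.
by rewrite (Prop_irrelevance o1 o2).
Qed.

Section signed_of_charge.
Variable nu : {charge set T -> \bar R}.

Definition cut_charge (A : set T) : \bar R :=
  if pselect (measurable A) then nu A else 0%E.

Lemma cut_chargeE A : measurable A -> cut_charge A = nu A.
Proof. by rewrite /cut_charge; case: pselect. Qed.

Let cut_charge0 : cut_charge set0 = 0%E.
Proof. by rewrite cut_chargeE// charge0. Qed.

Let cut_charge_finite A : measurable A -> cut_charge A \is a fin_num.
Proof. by move=> mA; rewrite cut_chargeE//; exact: fin_num_measure. Qed.

Let cut_charge_sigma_additive : semi_sigma_additive cut_charge.
Proof.
move=> F mF tF mUF; rewrite cut_chargeE//.
under eq_fun do under eq_bigr do rewrite cut_chargeE//.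
exact: charge_semi_sigma_additive.
Qed.

HB.instance Definition _ := isCharge.Build _ _ _ cut_charge
  cut_charge0 cut_charge_finite cut_charge_sigma_additive.

Let cut_charge_out A : ~ measurable A -> cut_charge A = 0%E.
Proof. by rewrite /cut_charge; case: pselect. Qed.

Definition signed_of_charge : SM :=
  @SignedMeasure _ T R cut_charge cut_charge_out.

End signed_of_charge.

HB.instance Definition _ := gen_eqMixin SM.
HB.instance Definition _ := gen_choiceMixin SM.

Definition sm_zero : SM := signed_of_charge czero.
Definition sm_opp (m : SM) : SM := signed_of_charge (copp m).
Definition sm_add (m1 m2 : SM) : SM := signed_of_charge (cadd m1 m2).
Definition sm_scale (r : R) (m : SM) : SM := signed_of_charge (cscale r m).

Let fin (m : SM) A : measurable A -> m A \is a fin_num.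
Proof. exact: fin_num_measure. Qed.

Let sm_addA : associative sm_add.
Proof.
by move=> a b c; apply/signed_measureP => A mA;
  rewrite /= !cut_chargeE//= /cadd/= !cut_chargeE//= /cadd/= addeA.
Qed.

Let sm_addC : commutative sm_add.
Proof.
by move=> a b; apply/signed_measureP => A mA;
  rewrite /= !cut_chargeE//= /cadd/= addeC.
Qed.

Let sm_add0 : left_id sm_zero sm_add.
Proof.
by move=> a; apply/signed_measureP => A mA;
  rewrite /= !cut_chargeE//= /cadd/= !cut_chargeE//= add0e.
Qed.

Let sm_addN : left_inverse sm_zero sm_opp sm_add.
Proof.
move=> a; apply/signed_measureP => A mA.
by rewrite /= !cut_chargeE//= /cadd/= !cut_chargeE//= /copp addeC subee// fin.
Qed.

HB.instance Definition _ :=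
  GRing.isZmodule.Build SM sm_addA sm_addC sm_add0 sm_addN.

Let sm_scaleA a b m : sm_scale a (sm_scale b m) = sm_scale (a * b) m.
Proof.
by apply/signed_measureP => A mA;
  rewrite /= !cut_chargeE//= /cscale/= !cut_chargeE//= /cscale/= EFinM muleA.
Qed.

Let sm_scale1 : left_id 1 sm_scale.
Proof.
by move=> m; apply/signed_measureP => A mA;
  rewrite /= !cut_chargeE//= /cscale/= mul1e.
Qed.

Let sm_scaleDr : right_distributive sm_scale +%R.
Proof.
move=> a m1 m2; apply/signed_measureP => A mA.
rewrite /= !cut_chargeE//= /cscale /cadd/= !cut_chargeE//= /cscale /cadd/=.
by rewrite muleDr// ?fin_num_adde_defl ?fin.
Qed.

Let sm_scaleDl m : {morph sm_scale^~ m : a b / a + b}.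
Proof.
move=> a b; apply/signed_measureP => A mA.
rewrite /= !cut_chargeE//= /cscale /cadd/= !cut_chargeE//= /cscale/=.
by rewrite -(fineK (fin m mA)) -!EFinM -EFinD mulrDl.
Qed.

HB.instance Definition _ := GRing.Zmodule_isLmodule.Build R SM
  sm_scaleA sm_scale1 sm_scaleDr sm_scaleDl.

Lemma signed_measureD (m1 m2 : SM) A : measurable A ->
  (m1 + m2) A = (m1 A + m2 A)%E.
Proof. by move=> mA; rewrite [LHS]cut_chargeE. Qed.

Lemma signed_measureN (m : SM) A : measurable A -> (- m) A = (- m A)%E.
Proof. by move=> mA; rewrite [LHS]cut_chargeE. Qed.

Lemma signed_measureZ r (m : SM) A : measurable A ->
  (r *: m) A = (r%:E * m A)%E.
Proof. by move=> mA; rewrite [LHS]cut_chargeE. Qed.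

Definition is_probability (m : SM) : Prop :=
  exists P : probability T R, forall A, measurable A -> m A = P A.

Definition transfer (S : {mfun T >-> T}) (nu : SM) : SM :=
  signed_of_charge
    (measure_function_pushforward__canonical__charge_Charge nu
       (measurable_funPT S)).

Lemma transferE (S : {mfun T >-> T}) (nu : SM) A : measurable A ->
  transfer S nu A = nu (S @^-1` A).
Proof. by move=> mA; rewrite [LHS]cut_chargeE. Qed.

Let transfer_linear S : linear (transfer S).
Proof.
move=> a u v; apply/signed_measureP => A mA.
have mSA : measurable (S @^-1` A).
  by rewrite -[X in measurable X]setTI; exact: measurable_funPT.
by rewrite transferE// !(signed_measureD, signed_measureZ)// !transferE.
Qed.

HB.instance Definition _ S :=
  GRing.isLinear.Build R SM SM *:%R (transfer S) (transfer_linear S).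

Definition zero_mass (B : set SM) : set SM :=
  [set f | B f /\ f [set: T] = 0%E].

End signed_measure_theory.

(* The norm of a normed subspace B of V, given as a function on V of which only
   the values on B matter. *)
Record norm_on (R : realType) (V : lmodType R) (B : set V) (N : V -> R) :
    Prop := NormOn {
  norm_onD : forall u v, B u -> B v -> N (u + v) <= N u + N v;
  norm_onZ : forall a u, B u -> N (a *: u) = `|a| * N u;
  norm_on0_eq0 : forall u, B u -> N u = 0 -> u = 0 }.

Definition opnorm (R : realType) (V : lmodType R) (B : set V) (N N' : V -> R)
    (L : V -> V) : \bar R :=
  ereal_sup [set (N' (L f))%:E | f in [set f | B f /\ N f <= 1]].

Definition convergence_to_equilibrium d (T : measurableType d) (R : realType)
    (Bs : set (signed_measure T R)) (ns nw : signed_measure T R -> R)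
    (L : signed_measure T R -> signed_measure T R) (phi : R -> R) : Prop :=
  forall n g, zero_mass Bs g -> nw (iter n L g) <= phi n%:R * ns g.

(* Main.v *)
(* The fixed points satisfy, for every n,
     f1 - f0 = L0^n (f1 - f0) + (f1 - L0^n f1).
   The first term is at most phi(n) * 2M by convergence to equilibrium. Since
   f1 = L1 f1, the second one telescopes into n terms L0^k (L1 - L0) f1, each of
   norm at most C eps M. For x = psi^-1(eps C / 2), that is
   phi(x) = x eps C / 2, the choice n = floor(x) + 1 balances the two terms. *)
Require Import Defs.
From mathcomp Require Import all_boot all_order all_algebra.
From mathcomp Require Import all_classical all_reals all_analysis.
From mathcomp Require Import lra.

Set Implicit Arguments.
Unset Strict Implicit.
Unset Printing Implicit Defensive.

Import Order.TTheory GRing.Theory Num.Theory.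
Import numFieldNormedType.Exports.

Local Open Scope classical_set_scope.
Local Open Scope ring_scope.

Section norms.
Context (R : realType) (V : lmodType R).
Implicit Types (B : set V) (N : V -> R) (L : V -> V).

Lemma submod_closed0 B : submod_closed [in B] -> B 0.
Proof. by case=> /set_mem. Qed.

Lemma submod_closedP B a u v : submod_closed [in B] -> B u -> B v ->
  B (a *: u + v).
Proof. by case=> _ closedB Bu Bv; apply/set_mem/closedB; exact: mem_set. Qed.

Lemma submod_closedB B u v : submod_closed [in B] -> B u -> B v -> B (u - v).
Proof.
by move=> subB Bu Bv; rewrite addrC -scaleN1r; exact: submod_closedP.
Qed.

Lemma submod_closedZ B a u : submod_closed [in B] -> B u -> B (a *: u).
Proof.
move=> subB Bu; rewrite -[_ *: _]addr0.
by apply: submod_closedP => //; exact: submod_closed0.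
Qed.

Lemma norm_on0 B N : norm_on B N -> submod_closed [in B] -> N 0 = 0.
Proof.
move=> normN /submod_closed0 B0.
by rewrite -(scale0r (0 : V)) (norm_onZ normN)// normr0 mul0r.
Qed.

Lemma norm_onN B N u : norm_on B N -> B u -> N (- u) = N u.
Proof.
by move=> normN Bu; rewrite -scaleN1r (norm_onZ normN)// normrN normr1 mul1r.
Qed.

Lemma norm_onB B N u v : norm_on B N -> submod_closed [in B] ->
  B u -> B v -> N (u - v) <= N u + N v.
Proof.
move=> normN subB Bu Bv; rewrite -(norm_onN normN Bv).
apply: (norm_onD normN) => //.
by rewrite -scaleN1r; exact: submod_closedZ.
Qed.

(** Positivity is not a field of [norm_on]; it follows from the others, since
    [0 = N (u - u) <= N u + N u]. *)
Lemma norm_on_ge0 B N u : norm_on B N -> submod_closed [in B] -> B u ->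
  0 <= N u.
Proof.
move=> normN subB Bu; have := norm_onB normN subB Bu Bu.
by rewrite subrr (norm_on0 normN subB) -mulr2n pmulrn_lge0.
Qed.

(** The zero vector lies in the unit ball and contributes the value 0 to the supremum. *)
Lemma opnorm_ge0 B B' N N' L :
  norm_on B N -> submod_closed [in B] ->
  norm_on B' N' -> submod_closed [in B'] -> L 0 = 0 ->
  (0%:E <= opnorm B N N' L)%E.
Proof.
move=> normN subB normN' subB' L0; apply: ereal_sup_ubound.
exists 0; first by split; [exact: submod_closed0|rewrite (norm_on0 normN)].
by rewrite L0 (norm_on0 normN').
Qed.

(** Scaling [u] to norm 1 brings it into the unit ball over which the supremum runs. If [N u = 0] no
    scaling is possible, but then definiteness gives [u = 0]. *)
Lemma le_opnorm B B' N N' L c u :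
  norm_on B N -> submod_closed [in B] ->
  norm_on B' N' -> submod_closed [in B'] ->
  scalable L -> {homo L : x / B x >-> B' x} ->
  (opnorm B N N' L <= c%:E)%E -> B u -> N' (L u) <= c * N u.
Proof.
move=> normN subB normN' subB' LZ BL leLc Bu.
have := norm_on_ge0 normN subB Bu; rewrite le_eqVlt => /predU1P[Nu0|Nu_gt0].
  rewrite -Nu0 mulr0 (norm_on0_eq0 normN Bu)//.
  by rewrite -(scale0r (0 : V)) LZ scale0r (norm_on0 normN').
rewrite -ler_pdivrMr// mulrC -lee_fin; apply: le_trans leLc.
have Nu_inv : `|(N u)^-1| = (N u)^-1 by rewrite gtr0_norm// invr_gt0.
apply: ereal_sup_ubound; exists ((N u)^-1 *: u).
  split; first exact: submod_closedZ.
  by rewrite (norm_onZ normN)// Nu_inv mulVf// gt_eqF.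
by rewrite LZ (norm_onZ normN') ?Nu_inv//; exact: BL.
Qed.

End norms.

Section iterates.
Context (R : realType) (V : lmodType R) (L : {linear V -> V}).

Lemma iterB n u v : iter n L (u - v) = iter n L u - iter n L v.
Proof. by elim: n => //= n ->; rewrite linearB. Qed.

Lemma iter_scalable n : scalable (iter n L).
Proof. by elim: n => // n IHn a u; rewrite /= IHn linearZ. Qed.

Lemma iter_stable (B : set V) n : L @` B `<=` B ->
  {homo iter n L : x / B x}.
Proof.
by move=> LB x Bx; elim: n => //= n IHn; apply: LB; exists (iter n L x).
Qed.

(** Telescoping: [L^n g - g] is the sum over [k < n] of [L^k (L g - g)], and [c] bounds each
    term. *)
Lemma le_norm_iterB (B : set V) (N : V -> R) c g n :
  norm_on B N -> submod_closed [in B] -> L @` B `<=` B -> B g ->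
  (forall k, N (iter k L (L g - g)) <= c) ->
  N (iter n L g - g) <= n%:R * c.
Proof.
move=> normN subB LB Bg le_c; elim: n => [|n IHn].
  by rewrite subrr (norm_on0 normN subB) mul0r.
have BLg : B (L g) by apply: LB; exists g.
rewrite iterSr -(subrK (iter n L g) (iter n L (L g))) -addrA -iterB.
rewrite mulrSr mulrDl mul1r addrC.
have Bn h := iter_stable n LB (x := h).
apply: (le_trans (norm_onD normN _ _)); last exact: lerD.
  by apply: submod_closedB => //; exact: Bn.
by apply: Bn; exact: submod_closedB.
Qed.

End iterates.

(** The total masses 1 cancel, so convergence to equilibrium applies to the difference of the two
    invariant measures. *)
Lemma zero_massB d (T : measurableType d) (R : realType)
    (B : set (signed_measure T R)) f g :
  submod_closed [in B] -> B f -> B g -> is_probability f -> is_probability g ->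
  zero_mass B (f - g).
Proof.
move=> subB Bf Bg [P fP] [Q gQ]; split; first exact: submod_closedB.
rewrite signed_measureD// signed_measureN// fP// gQ//.
by rewrite !probability_setT subee.
Qed.

Theorem theorem5 (R : realType) (X : pmetricType R)
  (Bs Bw : set (signed_measure (borel X) R))
  (ns nw : signed_measure (borel X) R -> R)
  (T0 T1 : {mfun borel X >-> borel X})
  (f0 f1 : signed_measure (borel X) R)
  (phi : R -> R) (M C eps : R)
  (Bs_sub : submod_closed [in Bs]) (Bw_sub : submod_closed [in Bw])
  (Bs_norm : norm_on Bs ns) (Bw_norm : norm_on Bw nw)
  (BsBw : Bs `<=` Bw)
  (nw_le_ns : forall f, Bs f -> nw f <= ns f)
  (L0Bs : transfer T0 @` Bs `<=` Bs) (L1Bs : transfer T1 @` Bs `<=` Bs)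
  (L0Bw : transfer T0 @` Bw `<=` Bw) (L1Bw : transfer T1 @` Bw `<=` Bw)
  (Bsf0 : Bs f0) (Bsf1 : Bs f1)
  (f0_prob : is_probability f0) (f1_prob : is_probability f1)
  (L0f0 : transfer T0 f0 = f0) (L1f1 : transfer T1 f1 = f1)
  (phi_cont : continuous phi)
  (phi_decr : {in `]0, +oo[ &, {homo phi : x y /~ x <= y}})
  (phi_lim : phi x @[x --> +oo] --> 0)
  (L0_conv : convergence_to_equilibrium Bs ns nw (transfer T0) phi)
  (M_ge0 : 0 <= M) (f_le_M : Num.max (ns f1) (ns f0) <= M)
  (C_ge0 : 0 <= C)
  (L0_bound : forall n, (opnorm Bw nw nw (iter n (transfer T0)) <= C%:E)%E)
  (epsE : opnorm Bs ns nw (transfer T1 \- transfer T0) = eps%:E) :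
  let psi x := phi x / x in
  let psi_inv := 'pinv_(fun=> 0) `]0, +oo[ psi in
  (psi @` `]0, +oo[) (eps * C / 2) ->
  nw (f1 - f0) <= 2 * M * C * eps * (psi_inv (eps * C / 2) + 1).
Proof.
move=> psi psi_inv psi_range; set y := eps * C / 2 in psi_range *.
(* As [y] is in the range of [psi], the partial inverse returns a true preimage in the open
   half-line, not its default value 0. *)
have x_gt0 : 0 < psi_inv y.
  have : `]0, +oo[%classic (psi_inv y).
    by apply: (@surjpinv_image_sub _ _ _ _ (psi @` `]0, +oo[) psi) => //;
      exists y.
  by rewrite /= in_itv/= andbT.
have psix : psi (psi_inv y) = y.
  by apply: (@pinvK _ _ _ `]0, +oo[ psi); exact: mem_set.
move: (psi_inv y) x_gt0 psix => x x_gt0 psix.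
have phix : phi x = y * x by rewrite -psix divfK ?gt_eqF.
have eps_ge0 : 0 <= eps.
  rewrite -lee_fin -epsE; apply: (opnorm_ge0 Bs_norm Bs_sub Bw_norm Bw_sub).
  by rewrite /= !linear0 addr0.
move: f_le_M; rewrite ge_max => /andP[f1M f0M].
(* Both bounds on [N] matter: [x <= N] gives [phi N <= phi x], and [N <= x + 1] limits the number of
   telescoped terms. The successor keeps [N] positive, where [phi] is known to decrease. *)
set N := (Num.trunc x).+1.
have xN : x <= N%:R by rewrite ltW// -truncn_le_nat.
have Nx : N%:R <= x + 1.
  by rewrite -natr1 lerD2r -truncn_ge_nat// ltW.
have Bwf0 := BsBw _ Bsf0; have Bwf1 := BsBw _ Bsf1.
have equilibrium : nw (iter N (transfer T0) (f1 - f0)) <= y * x * (2 * M).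
  have Vf := zero_massB Bs_sub Bsf1 Bsf0 f1_prob f0_prob.
  have nsf_ge0 := norm_on_ge0 Bs_norm Bs_sub Vf.1.
  apply: (le_trans (L0_conv N _ Vf)); rewrite -phix.
  apply: (@le_trans _ _ (phi x * ns (f1 - f0))).
    by rewrite ler_wpM2r// phi_decr// in_itv/= andbT.
  (* [phi x] is nonnegative because it equals [y * x]; the factor 2 comes from
     [ns f1 + ns f0 <= 2 * M]. *)
  apply: ler_wpM2l.
    by rewrite phix mulr_ge0 ?(ltW x_gt0)// divr_ge0 ?mulr_ge0.
  by have := norm_onB Bs_norm Bs_sub Bsf1 Bsf0; lra.
have perturbation k :
    nw (iter k (transfer T0) (transfer T0 f1 - f1)) <= C * (eps * M).
  have BwLf : Bw (transfer T0 f1 - f1).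
    by apply: submod_closedB => //; apply: L0Bw; exists f1.
  apply: (le_trans (le_opnorm Bw_norm Bw_sub Bw_norm Bw_sub _ _ (L0_bound k)
    BwLf)).
  - exact: iter_scalable.
  - exact: iter_stable.
  apply: ler_wpM2l => //.
  apply: (@le_trans _ _ (eps * ns f1)); last exact: ler_wpM2l.
  (* Invariance of [f1] under [L1] turns [f1 - L0 f1] into [(L1 - L0) f1], which [eps] controls. *)
  rewrite -(norm_onN Bw_norm)// opprB -{1}L1f1.
  apply: (@le_opnorm _ _ _ _ _ _ (transfer T1 \- transfer T0) eps f1
    Bs_norm Bs_sub Bw_norm Bw_sub) => //.
  - by move=> a u; rewrite [LHS]/= (linearZZ (transfer T1))
      (linearZZ (transfer T0)) -scalerBr.
  - move=> u Bsu; apply: BsBw; apply: submod_closedB => //.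
      by apply: L1Bs; exists u.
    by apply: L0Bs; exists u.
  - by rewrite epsE.
have drift := le_norm_iterB N Bw_norm Bw_sub L0Bw Bwf1 perturbation.
have L0Nf0 : iter N (transfer T0) f0 = f0 by rewrite iter_fix.
have split_f :
    f1 - f0 = iter N (transfer T0) (f1 - f0) - (iter N (transfer T0) f1 - f1).
  by rewrite iterB L0Nf0 opprB [RHS]addrC addrA subrK.
have BwN g : Bw g -> Bw (iter N (transfer T0) g) by exact: iter_stable.
have le_sum : nw (f1 - f0) <= y * x * (2 * M) + N%:R * (C * (eps * M)).
  have Bwf10 := BwN _ (submod_closedB Bw_sub Bwf1 Bwf0).
  have Bwdrift := submod_closedB Bw_sub (BwN _ Bwf1) Bwf1.
  rewrite split_f; apply: (le_trans (norm_onB Bw_norm Bw_sub Bwf10 Bwdrift)).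
  exact: lerD.
apply: (le_trans le_sum).
have CeM_ge0 : 0 <= C * (eps * M) by rewrite !mulr_ge0.
(* With [y = eps * C / 2] the two terms are at most [C * eps * M * x] and [C * eps * M * (x + 1)].
   Their sum has factor [2 * x + 1], below the claimed [2 * (x + 1)]. *)
have := ler_wpM2r CeM_ge0 Nx; rewrite /y; nra.
Qed.
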